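(* Consider the system $x(t+1)=x(t)-L(t)x(t)$ and let $A_{\max}>0$ and $\alpha>0$ be constants such that almost surely $\sum_{i\in I}\sum_{j\ne i}a_{ij}(t)\le A_{\max}$ and $a_{ii}(t)\ge\alpha$ for all $i\in I$. If $\mathbf{1}^*\mathbb{E}(L(t))=0$, then $$\mathbb{E}[L(t)^*\mathbf{1}\mathbf{1}^*L(t)]\le\gamma\,\mathbb{E}[L(t)+L(t)^*-L(t)^*L(t)]\quad\text{with }\gamma=\frac{A_{\max}}{\alpha},$$ and consequently $\mathbb{E}[(\bar x(t)-\bar x(0))^2]\le\frac{\gamma}{N+\gamma}V(x(0))$ for all $t\ge0$.
   Context: Let $I$ be a finite set of $N$ nodes. For each $t\in\mathbb{Z}_{\ge0}$ let $A(t)=(a_{ij}(t))_{i,j\in I}$ be a random matrix with $a_{ij}(t)\ge 0$ and $\sum_{\ell\in I}a_{i\ell}(t)=1$ for all $i$ (so $a_{ii}(t)=1-\sum_{j\ne i}a_{ij}(t)$); the matrices $A(t)$ are i.i.d. in $t$. $L(t)$ is the Laplacian: $L_{ij}(t)=-a_{ij}(t)$ for $i\ne j$, $L_{ii}(t)=\sum_{j\ne i}a_{ij}(t)$. $x(0)\in\mathbb{R}^I$ is deterministic. $\mathbf{1}$ is the all-ones vector, $M^*$ the transpose; for $y\in\mathbb{R}^I$, $\bar y=\frac1N\sum_i y_i$, $V(y)=\frac1N\sum_i(y_i-\bar y)^2$. For square matrices, $A\le B$ means $A-B$ is negative semidefinite. *)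

(* Defs.v *)
From HB Require Import structures.
From mathcomp Require Import all_boot all_order all_algebra.
From mathcomp Require Import all_classical all_reals all_analysis.
Set Implicit Arguments. Unset Strict Implicit. Unset Printing Implicit Defensive.
Import Order.TTheory GRing.Theory Num.Theory.
Local Open Scope classical_set_scope.
Local Open Scope ring_scope.

Section Defs.
Context {R : realType} {n : nat}.

Definition laplacian (A : 'M[R]_n) : 'M[R]_n :=
  \matrix_(i, j) (if i == j then \sum_(k < n | k != i) A i k else - A i j).

Definition ones : 'cV[R]_n := const_mx 1.

Definition avg (y : 'cV[R]_n) : R := (\sum_(i < n) y i 0) / n%:R.
Definition Var (y : 'cV[R]_n) : R := (\sum_(i < n) (y i 0 - avg y) ^+ 2) / n%:R.

(* positive semidefinite (for the symmetric matrices considered) and the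
   Loewner order: A <= B iff A - B negative semidefinite iff B - A psd *)
Definition psd (M : 'M[R]_n) : Prop := forall v : 'cV[R]_n, 0 <= (v^T *m M *m v) 0 0.
Definition loewner_le (A B : 'M[R]_n) : Prop := psd (B - A).

Context {d : measure_display} {T : measurableType d}.

Definition Emx (P : probability T R) (M : T -> 'M[R]_n) : 'M[R]_n :=
  \matrix_(i, j) Rintegral P setT (fun w => M w i j).

Definition mx_event (M : T -> 'M[R]_n) (B : 'I_n -> 'I_n -> set R) : set T :=
  [set w | forall i j, B i j (M w i j)].

(* i.i.d. sequence of random matrices: measurable entries, mutual independence
   of the joint laws of the A t (product rule on rectangle events over every
   finite set of distinct times), and identical distribution. *)
Definition iid_mx (P : probability T R) (A : nat -> T -> 'M[R]_n) : Prop :=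
  [/\ (forall t i j, measurable_fun setT (fun w => A t w i j)),
      (forall (S : seq nat) (B : nat -> 'I_n -> 'I_n -> set R),
          uniq S -> (forall t i j, measurable (B t i j)) ->
          P [set w | forall t, t \in S -> mx_event (A t) (B t) w]
          = (\prod_(t <- S) fine (P (mx_event (A t) (B t))))%:E) &
      (forall t (B : 'I_n -> 'I_n -> set R), (forall i j, measurable (B i j)) ->
          P (mx_event (A t) B) = P (mx_event (A 0%N) B))].

End Defs.

Fixpoint traj {R : realType} {n : nat} {T : Type} (A : nat -> T -> 'M[R]_n)
    (x0 : 'cV[R]_n) (t : nat) (w : T) : 'cV[R]_n :=
  match t with
  | 0%N => x0
  | t'.+1 => traj A x0 t' w - laplacian (A t' w) *m traj A x0 t' w
  end.

(* Main.v *)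
Require Import Defs.
From HB Require Import structures.
From mathcomp Require Import all_boot all_order all_algebra.
From mathcomp Require Import all_classical all_reals all_analysis.
From mathcomp Require Import measurable_realfun.
From mathcomp Require Import ring lra.
Import Order.TTheory GRing.Theory Num.Theory.
Local Open Scope classical_set_scope.
Local Open Scope ring_scope.

(** Since [A] is row-stochastic, [L = 1 - A] and the column sums of [L] are
    [c_j = 1 - \sum_i a_ij]. For every vector [v], the quadratic form
    [v^* (L + L^* - L^* L) v = |v|^2 - |A v|^2] equals [\sum_j c_j v_j^2] plus
    the sum over [i] of the variance of [v] under the weights [a_i.]; each of
    these variances is at least [alpha \sum_(j != i) a_ij (v_i - v_j)^2], while
    Cauchy-Schwarz bounds [(1^* L v)^2] by
    [Amax \sum_i \sum_(j != i) a_ij (v_i - v_j)^2]. As [E c_j = 0], taking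
    expectations gives the matrix inequality.

    Let [z(t) = x(t) - avg x(0) 1], so that [z(t+1) = A(t) z(t)]. The pointwise
    inequality shows that [gamma |z|^2 + (1^* z)^2] decreases up to a term
    [\sum_j X_j c_j(t)] in which [X_j] depends only on [A(0), ..., A(t-1)]; this
    term has zero mean by independence. Hence the expectation of
    [gamma |z|^2 + (1^* z)^2 >= N (N + gamma) (avg z)^2] is nonincreasing, and
    it starts at [gamma N Var x(0)]. *)

Set Implicit Arguments.
Unset Strict Implicit.

(** The quadratic [l |-> \sum_i a i * (u i - l) ^+ 2] is nonnegative, and evaluating it at its
    minimizer [D / W] gives [D ^+ 2 <= W * S]. When the total weight [W] is zero, every weight
    vanishes and so does [D]. *)
Lemma weighted_cauchy_schwarz (R : realFieldType) (I : finType) (Q : pred I)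
    (a u : I -> R) (M : R) :
  (forall i, Q i -> 0 <= a i) -> \sum_(i | Q i) a i <= M ->
  (\sum_(i | Q i) a i * u i) ^+ 2 <= M * \sum_(i | Q i) a i * u i ^+ 2.
Proof.
move=> a0 aM.
have Q0 : 0 <= \sum_(i | Q i) a i * u i ^+ 2.
  by apply: sumr_ge0 => i Qi; rewrite mulr_ge0 ?a0 ?sqr_ge0.
have W0 : 0 <= \sum_(i | Q i) a i by apply: sumr_ge0.
have key l : 0 <= \sum_(i | Q i) a i * u i ^+ 2
    - 2 * l * (\sum_(i | Q i) a i * u i) + l ^+ 2 * \sum_(i | Q i) a i.
  rewrite !mulr_sumr -sumrB -big_split /=; apply: sumr_ge0 => i Qi.
  have -> : a i * u i ^+ 2 - 2 * l * (a i * u i) + l ^+ 2 * a i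
            = a i * (u i - l) ^+ 2 by ring.
  by rewrite mulr_ge0 ?a0 ?sqr_ge0.
apply: le_trans (ler_wpM2r Q0 aM); move: W0 Q0 key.
set W := \sum_(i | Q i) a i; set D := \sum_(i | Q i) a i * u i.
set S := \sum_(i | Q i) a i * u i ^+ 2 => W0 S0 key.
have [W_eq0|Wn0] := eqVneq W 0.
  have -> : D = 0.
    apply: big1 => i Qi; have /eqP := W_eq0; rewrite psumr_eq0 //.
    by move/allP/(_ i (mem_index_enum _)); rewrite Qi => /eqP ->; rewrite mul0r.
  by rewrite W_eq0 mul0r expr0n.
have Wp : 0 < W by rewrite lt_def Wn0.
have := key (D / W).
have -> : S - 2 * (D / W) * D + (D / W) ^+ 2 * W = (W * S - D ^+ 2) / W by field.
by rewrite pmulr_lge0 ?invr_gt0 // subr_ge0.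
Qed.

(** * Pointwise inequalities for a row-stochastic matrix *)

Section StochasticMatrix.
Context {R : realType} {n : nat}.
Implicit Types (A : 'M[R]_n) (v : 'cV[R]_n).

(* The [j]-th column sum of the Laplacian of a row-stochastic matrix. *)
Definition col_deficit A (j : 'I_n) : R := 1 - \sum_(i < n) A i j.

Lemma laplacian_stochastic A :
  (forall i, \sum_(l < n) A i l = 1) -> laplacian A = 1%:M - A.
Proof.
move=> A1; apply/matrixP => i j; rewrite !mxE; case: eqVneq => [->|_].
  by rewrite -(A1 j) [in RHS](bigD1 j) //= mulr1n addrAC subrr add0r.
by rewrite sub0r.
Qed.

Lemma sum_laplacian_mulmx A v :
  \sum_i ((1%:M - A) *m v) i 0 = \sum_j col_deficit A j * v j 0.
Proof.
rewrite mulmxBl mul1mx.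
under eq_bigr do rewrite !mxE.
rewrite sumrB exchange_big -sumrB /=; apply: eq_bigr => j _.
by rewrite -mulr_suml /col_deficit mulrBl mul1r.
Qed.

(** The right-hand side is a variance, hence equals [S - D ^+ 2] for the moments [D] and [S] of the
    differences [v i 0 - v j 0]. The off-diagonal weights add up to at most [1 - alpha], so
    Cauchy-Schwarz gives [D ^+ 2 <= (1 - alpha) * S]. *)
Lemma row_variance_ge A v (alpha : R) i :
  (forall j, 0 <= A i j) -> \sum_(l < n) A i l = 1 -> alpha <= A i i ->
  alpha * (\sum_(j < n | j != i) A i j * (v i 0 - v j 0) ^+ 2) <=
  \sum_j A i j * v j 0 ^+ 2 - (A *m v) i 0 ^+ 2.
Proof.
move=> A0 A1 Aii.
set D := \sum_(j < n | j != i) A i j * (v i 0 - v j 0).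
set S := \sum_(j < n | j != i) A i j * (v i 0 - v j 0) ^+ 2.
have S0 : 0 <= S by apply: sumr_ge0 => j _; rewrite mulr_ge0 ?sqr_ge0.
have DE : (A *m v) i 0 = v i 0 - D.
  rewrite mxE -[X in X - D]mul1r -A1 mulr_suml.
  (* The diagonal term is zero, so the sum may run over all [j]. *)
  have -> : D = \sum_j A i j * (v i 0 - v j 0).
    by rewrite [RHS](bigD1 i) //= subrr mulr0 add0r.
  by rewrite -sumrB; apply: eq_bigr => j _; ring.
have SE : \sum_j A i j * v j 0 ^+ 2 = v i 0 ^+ 2 - 2 * v i 0 * D + S.
  have -> : D = \sum_j A i j * (v i 0 - v j 0).
    by rewrite [RHS](bigD1 i) //= subrr mulr0 add0r.
  have -> : S = \sum_j A i j * (v i 0 - v j 0) ^+ 2.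
    by rewrite [RHS](bigD1 i) //= subrr expr0n mulr0 add0r.
  have vE : v i 0 ^+ 2 = \sum_j A i j * v i 0 ^+ 2 by rewrite -mulr_suml A1 mul1r.
  rewrite vE mulr_sumr -sumrB -big_split /=.
  by apply: eq_bigr => j _; ring.
have : D ^+ 2 <= (1 - alpha) * S.
  apply: weighted_cauchy_schwarz => //.
  by move: A1; rewrite (bigD1 i) //= => A1; lra.
by rewrite SE DE; nra.
Qed.

(** The deficits have no definite sign for a single matrix and vanish only in mean, so their
    contribution stays in the inequality. The pointwise form serves both a fixed [v] and the random
    state of the system. *)
Lemma quadratic_drift_ge A v (Amax alpha : R) :
  (forall i j, 0 <= A i j) -> (forall i, \sum_(l < n) A i l = 1) ->
  0 < Amax -> 0 < alpha ->
  \sum_(i < n) \sum_(j < n | j != i) A i j <= Amax ->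
  (forall i, alpha <= A i i) ->
  (\sum_j col_deficit A j * v j 0) ^+ 2
    + Amax / alpha * (\sum_j col_deficit A j * v j 0 ^+ 2)
  <= Amax / alpha * (\sum_j v j 0 ^+ 2 - \sum_i (A *m v) i 0 ^+ 2).
Proof.
move=> A0 A1 M0 al0 AM Aal.
set Q := \sum_(i < n) \sum_(j < n | j != i) A i j * (v i 0 - v j 0) ^+ 2.
have DE : \sum_j col_deficit A j * v j 0
    = \sum_(i < n) \sum_(j < n | j != i) A i j * (v i 0 - v j 0).
  rewrite -sum_laplacian_mulmx; apply: eq_bigr => i _.
  rewrite mulmxBl mul1mx !mxE -[X in X - _]mul1r -(A1 i) mulr_suml -sumrB.
  rewrite (bigD1 i) //= subrr add0r.
  by apply: eq_bigr => j _; rewrite mulrBr.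
(* Cauchy-Schwarz over all pairs [(i, j)] with [j != i], whose total weight is at most [Amax]. *)
have CS : (\sum_j col_deficit A j * v j 0) ^+ 2 <= Amax * Q.
  rewrite DE /Q pair_big_dep [in leRHS]pair_big_dep /=.
  by apply: weighted_cauchy_schwarz => //; rewrite pair_big_dep in AM.
have SE : \sum_j v j 0 ^+ 2 - \sum_i (A *m v) i 0 ^+ 2
    = \sum_j col_deficit A j * v j 0 ^+ 2
      + \sum_i (\sum_j A i j * v j 0 ^+ 2 - (A *m v) i 0 ^+ 2).
  rewrite sumrB addrA; congr (_ - _).
  rewrite exchange_big -big_split /=; apply: eq_bigr => j _.
  by rewrite -mulr_suml /col_deficit; ring.
have VQ : alpha * Q <= \sum_i (\sum_j A i j * v j 0 ^+ 2 - (A *m v) i 0 ^+ 2).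
  by rewrite mulr_sumr; apply: ler_sum => i _; exact: row_variance_ge.
rewrite SE mulrDr addrC lerD2l; apply: (le_trans CS).
apply: le_trans (ler_wpM2l _ VQ); last by rewrite divr_ge0 // ltW.
by rewrite mulrA divfK ?gt_eqF.
Qed.

End StochasticMatrix.

(** * Bounded measurable functions, their expectations, and independence *)

Section BoundedMeasurable.
Context {R : realType} {d : measure_display} {T : measurableType d}.
Implicit Types X Y : T -> R.

(** This class is closed under ring operations and consists of integrable functions. The
    sigma-algebra is carried by the type [T], so the same predicate also expresses measurability
    with respect to a generated sub-sigma-algebra. *)
Definition bmfun X :=
  measurable_fun setT X /\ exists M, forall w, `|X w| <= M.

Lemma bmfun_cst r : bmfun (fun _ => r).
Proof. by split; [exact: measurable_cst|exists `|r|]. Qed.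

Lemma bmfunD X Y : bmfun X -> bmfun Y -> bmfun (fun w => X w + Y w).
Proof.
move=> [mX [M XM]] [mY [N YN]]; split; first exact: measurable_funD.
by exists (M + N) => w; rewrite (le_trans (ler_normD _ _)) ?lerD.
Qed.

Lemma bmfunM X Y : bmfun X -> bmfun Y -> bmfun (fun w => X w * Y w).
Proof.
move=> [mX [M XM]] [mY [N YN]]; split; first exact: measurable_funM.
by exists (M * N) => w; rewrite normrM ler_pM.
Qed.

Lemma bmfunN X : bmfun X -> bmfun (fun w => - X w).
Proof.
move=> [mX [M XM]]; split; first exact: measurable_funN.
by exists M => w; rewrite normrN.
Qed.

Lemma bmfunB X Y : bmfun X -> bmfun Y -> bmfun (fun w => X w - Y w).
Proof. by move=> bX bY; apply: bmfunD => //; exact: bmfunN. Qed.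

Lemma bmfunX X k : bmfun X -> bmfun (fun w => X w ^+ k).
Proof.
move=> bX; elim: k => [|k IH]; first exact: (bmfun_cst 1).
by under eq_fun do rewrite exprS; exact: bmfunM.
Qed.

Lemma bmfun_sum (I : Type) (r : seq I) (Q : pred I) (F : I -> T -> R) :
  (forall i, bmfun (F i)) -> bmfun (fun w => \sum_(i <- r | Q i) F i w).
Proof.
move=> bF; elim: r => [|i r IH].
  by under eq_fun do rewrite big_nil; exact: bmfun_cst.
under eq_fun do rewrite big_cons.
by case: (Q i) => //; exact: bmfunD.
Qed.

Variable P : probability T R.

Lemma bmfun_integrable X : bmfun X -> P.-integrable setT (EFin \o X).
Proof.
move=> [mX [M XM]]; apply: measurable_bounded_integrable => //.
  by rewrite -ge0_fin_numE //; exact: fin_num_measure.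
exists M; split; first exact: num_real.
by move=> y My w _ /=; exact: le_trans (XM w) (ltW My).
Qed.

Lemma expectD X Y : bmfun X -> bmfun Y ->
  Rintegral P setT (fun w => X w + Y w)
  = Rintegral P setT X + Rintegral P setT Y.
Proof. by move=> bX bY; rewrite RintegralD //; exact: bmfun_integrable. Qed.

Lemma expectB X Y : bmfun X -> bmfun Y ->
  Rintegral P setT (fun w => X w - Y w)
  = Rintegral P setT X - Rintegral P setT Y.
Proof. by move=> bX bY; rewrite RintegralB //; exact: bmfun_integrable. Qed.

Lemma expectZl X r : bmfun X ->
  Rintegral P setT (fun w => r * X w) = r * Rintegral P setT X.
Proof. by move=> bX; rewrite RintegralZl //; exact: bmfun_integrable. Qed.

Lemma expect_cst r : Rintegral P setT (fun=> r) = r.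
Proof. by rewrite Rintegral_cst // -[LHS]/(r * fine (P setT)) probability_setT mulr1. Qed.

Lemma expect_sum (I : Type) (r : seq I) (F : I -> T -> R) :
  (forall i, bmfun (F i)) ->
  Rintegral P setT (fun w => \sum_(i <- r) F i w)
  = \sum_(i <- r) Rintegral P setT (F i).
Proof.
move=> bF; elim: r => [|i r IH].
  by under eq_Rintegral do rewrite big_nil; rewrite expect_cst big_nil.
under eq_Rintegral do rewrite big_cons.
by rewrite expectD // ?IH ?big_cons //; exact: bmfun_sum.
Qed.

(** The difference [Y - X] agrees almost everywhere with its absolute value, whose integral is
    nonnegative. *)
Lemma le_expect_ae X Y : bmfun X -> bmfun Y -> {ae P, forall w, X w <= Y w} ->
  Rintegral P setT X <= Rintegral P setT Y.
Proof.
move=> bX bY XY; rewrite -subr_ge0 -expectB //.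
have [mD _] := bmfunB bY bX.
have -> : Rintegral P setT (fun w => Y w - X w)
    = Rintegral P setT (fun w => `|Y w - X w|).
  congr fine; apply: ae_eq_integral => //.
  - exact/measurable_EFinP.
  - by apply/measurable_EFinP; exact: measurableT_comp.
  - by apply: filterS XY => w XYw _ /=; rewrite ger0_norm // subr_ge0.
by apply: Rintegral_ge0.
Qed.

End BoundedMeasurable.

(** The joint law of [(X, Y)] and the product of the marginal laws agree on rectangles, hence
    everywhere; Fubini then splits the integral of [z.1 * z.2]. *)
Lemma Rintegral_mul_independent (R : realType) (d : measure_display)
    (T : measurableType d) (P : probability T R) (X Y : T -> R) :
  bmfun X -> bmfun Y ->
  (forall B C : set R, measurable B -> measurable C ->
     P (X @^-1` B `&` Y @^-1` C) = (P (X @^-1` B) * P (Y @^-1` C))%E) ->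
  Rintegral P setT (fun w => X w * Y w)
  = Rintegral P setT X * Rintegral P setT Y.
Proof.
move=> bX bY XY.
have [mX _] := bX; have [mY _] := bY.
have iX := bmfun_integrable P bX; have iY := bmfun_integrable P bY.
pose X' : {RV P >-> R} := HB.pack X (isMeasurableFun.Build _ _ _ _ X mX).
pose Y' : {RV P >-> R} := HB.pack Y (isMeasurableFun.Build _ _ _ _ Y mY).
pose muX := distribution P X'; pose muY := distribution P Y'.
pose XxY := fun w => (X w, Y w).
have mXxY : measurable_fun setT XxY by exact/measurable_fun_pair.
pose Z : {mfun T >-> (R * R)%type} := HB.pack XxY (isMeasurableFun.Build _ _ _ _ XxY mXxY).
pose muZ := pushforward P Z.
pose f (z : R * R) : \bar R := (z.1 * z.2)%:E.
have mf : measurable_fun setT f.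
  apply/measurable_EFinP; apply: measurable_funM; [exact: measurable_fst|exact: measurable_snd].
have muZE C : measurable C -> (muX \x muY)%E C = muZ C.
  apply: product_measure_unique => B D mB mD.
  by rewrite /muX /muY /distribution /= /pushforward -XY.
have iXY := bmfun_integrable P (bmfunM bX bY).
have ifZ : muZ.-integrable setT f by apply: integrable_pushforward.
(* Integrability, required by Fubini, is transported from the joint law. *)
have if12 : (muX \x muY)%E.-integrable setT f.
  apply/integrableP; split => //.
  rewrite (eq_measure_integral muZ) => [|C mC _]; last exact: muZE.
  by case/integrableP : ifZ.
have iidX : muX.-integrable setT (@EFin R) by apply: integrable_pushforward.
have iidY : muY.-integrable setT (@EFin R) by apply: integrable_pushforward.
have EXE : (\int[muX]_x x%:E = \int[P]_w (X w)%:E)%E.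
  by rewrite integral_pushforward.
have EYE : (\int[muY]_y y%:E = \int[P]_w (Y w)%:E)%E.
  by rewrite integral_pushforward.
have fX := integrable_fin_num measurableT iX.
have fY := integrable_fin_num measurableT iY.
rewrite /Rintegral -fineM //; congr fine.
transitivity (\int[muZ]_z f z)%E; first by rewrite integral_pushforward.
rewrite (@eq_measure_integral _ _ _ _ (muX \x muY)%E) => [|C mC _]; last first.
  exact/esym/muZE.
rewrite -integral12_prod_meas1 // /fubini_F /f /=.
under eq_integral => x _.
  under eq_integral do rewrite EFinM.
  rewrite integralZl // EYE -(fineK fY).
  over.
by rewrite integralZr // fineK // EXE.
Qed.

Lemma sub_g_sigma_algebra_measurable_fun (d d' : measure_display)
    (T : measurableType d) (U : measurableType d') (G : set (set T))
    (X : T -> U) :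
  G `<=` measurable ->
  measurable_fun setT (X : g_sigma_algebraType G -> U) ->
  measurable_fun setT X.
Proof.
move=> GM mX _ B mB; have := mX measurableT B mB.
by apply: smallest_sub; [exact: sigma_algebra_measurable|].
Qed.

(** Dynkin's pi-lambda argument: the measurable events that satisfy the product rule with [F] form a
    lambda-system containing the pi-system [G]. *)
Lemma independent_g_sigma_algebra (R : realType) (d : measure_display)
    (T : measurableType d) (P : probability T R) (G : set (set T)) (F : set T) :
  setI_closed G -> G `<=` measurable -> measurable F ->
  (forall E, G E -> P (E `&` F) = (P E * P F)%E) ->
  forall E, <<s G >> E -> P (E `&` F) = (P E * P F)%E.
Proof.
move=> GI GM mF indep E sE.
suff /(_ _ sE)[] : <<s G >> `<=`
    [set E | measurable E /\ P (E `&` F) = (P E * P F)%E] by [].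
apply: lambda_system_subset => //; last first.
  by move=> C GC; split; [exact: GM|exact: indep].
apply/dynkin_lambda_system; split.
- by split => //; rewrite setTI probability_setT mul1e.
- move=> A [mA PA]; split; first exact: measurableC.
  have fin C : measurable C -> P C \is a fin_num by exact: fin_num_measure.
  have mAF : measurable (A `&` F) by exact: measurableI.
  have mCAF : measurable (~` A `&` F) by apply: measurableI => //; exact: measurableC.
  have : P F = (P (~` A `&` F) + P (A `&` F))%E.
    by rewrite (measureDI P mF mA) setDE [F `&` ~` _]setIC [F `&` A]setIC.
  have -> : P (~` A) = (1 - fine (P A))%:E.
    by rewrite probability_setC // EFinB fineK ?fin.
  rewrite PA -(fineK (fin _ mF)) -(fineK (fin _ mA)) -(fineK (fin _ mCAF)).
  by move=> [FE]; rewrite -EFinM; congr _%:E; move: FE; rewrite /=; lra.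
- move=> A tA PA.
  have mA k : measurable (A k) by case: (PA k).
  split; first exact: bigcupT_measurable.
  have mAF k : measurable (A k `&` F) by exact: measurableI.
  have tAF : trivIset setT (fun k => A k `&` F) by exact: trivIset_setIr.
  rewrite setI_bigcupl measure_bigcup // [P (\bigcup_n A n)]measure_bigcup //.
  rewrite -(fineK (fin_num_measure P _ mF)) muleC -nneseriesZl //.
  apply: eq_eseriesr => k _; rewrite muleC fineK ?fin_num_measure //.
  by case: (PA k).
Qed.

(** * The past of the process and its independence from the next matrix *)

Section History.
Context {R : realType} {n : nat} {d : measure_display} {T : measurableType d}.
Variables (P : probability T R) (A : nat -> T -> 'M[R]_n).

(* The pi-system of rectangle events on [A 0, ..., A (t - 1)]. *)
Definition history (t : nat) : set (set T) :=
  [set E | exists2 B : nat -> 'I_n -> 'I_n -> set R,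
     (forall s i j, measurable (B s i j)) &
     E = [set w | forall s, s \in iota 0 t -> mx_event (A s) (B s) w]].

Lemma history_setI_closed t : setI_closed (history t).
Proof.
move=> _ _ [B mB ->] [C mC ->].
exists (fun s i j => B s i j `&` C s i j).
  by move=> s i j; exact: measurableI.
apply/seteqP; split=> w /=.
  by move=> [wB wC] s st i j; split; [exact: wB|exact: wC].
by move=> h; split=> s st i j; have [] := h s st i j.
Qed.

(** Turns a condition on one entry into a rectangle event, the form in which [iid_mx] states
    independence. *)
Definition entry_box (i j : 'I_n) (C : set R) : 'I_n -> 'I_n -> set R :=
  fun i' j' => if (i' == i) && (j' == j) then C else setT.

Lemma measurable_entry_box i j C i' j' :
  measurable C -> measurable (entry_box i j C i' j').
Proof. by move=> mC; rewrite /entry_box; case: ifP. Qed.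

Lemma mx_event_entry_box s i j C :
  mx_event (A s) (entry_box i j C) = (fun w => A s w i j) @^-1` C.
Proof.
apply/seteqP; split=> w; rewrite /mx_event /entry_box /=.
  by move/(_ i j); rewrite !eqxx.
by move=> wC i' j'; case: ifP => // /andP[/eqP-> /eqP->].
Qed.

Hypothesis iidA : iid_mx P A.

Lemma history_measurable t : history t `<=` measurable.
Proof.
have [mA _ _] := iidA.
move=> _ [B mB ->].
rewrite (_ : [set w | _] = \bigcap_(s in [set` iota 0 t]) \bigcap_(i in setT)
    \bigcap_(j in setT) ((fun w => A s w i j) @^-1` B s i j)).
  apply: bigcap_measurableType => s _.
  do 2 (apply: fin_bigcap_measurable => [|? _]; first exact: finite_finset).
  by rewrite -[X in measurable X]setTI; exact: mA.
apply/seteqP; split=> w /=.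
  by move=> h s st i _ j _; exact: h.
by move=> h s st i j; exact: h.
Qed.

(** For a rectangle event of the past, the condition on [A t] is one more factor in the product rule
    over the times [0, ..., t]; the pi-lambda argument covers the rest of the generated
    sigma-algebra. *)
Lemma history_independent_entry t i j C E :
  measurable C -> <<s history t >> E ->
  P (E `&` (fun w => A t w i j) @^-1` C)
  = (P E * P ((fun w => A t w i j) @^-1` C))%E.
Proof.
have [mA indepA _] := iidA; move=> mC.
apply: independent_g_sigma_algebra.
- exact: history_setI_closed.
- exact: history_measurable.
- by rewrite -[X in measurable X]setTI; exact: mA.
move=> _ [B mB ->].
(* The sets of [B] at time [t] do not enter the past event, so they can be overwritten by the
   box. *)
pose B' s := if s == t then entry_box i j C else B s.
have mB' s i' j' : measurable (B' s i' j').
  by rewrite /B'; case: eqP => // _; exact: measurable_entry_box.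
have B'E s : s \in iota 0 t -> B' s = B s.
  by rewrite mem_iota add0n /B' => /andP[_]; case: ltngtP.
have Bt : B' t = entry_box i j C by rewrite /B' eqxx.
have iotaE : iota 0 t.+1 = iota 0 t ++ [:: t] by rewrite -addn1 iotaD.
have -> : [set w | forall s, s \in iota 0 t -> mx_event (A s) (B s) w] `&`
    (fun w => A t w i j) @^-1` C
    = [set w | forall s, s \in iota 0 t.+1 -> mx_event (A s) (B' s) w].
  rewrite iotaE -mx_event_entry_box -Bt; apply/seteqP; split=> w /=.
    move=> [h wt] s; rewrite mem_cat => /orP[st|].
      by rewrite B'E //; exact: h.
    by rewrite mem_seq1 => /eqP ->.
  move=> h; split; last by apply: h; rewrite mem_cat mem_head orbT.
  move=> s st; rewrite -B'E //; apply: h.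
  by rewrite mem_cat st.
rewrite !indepA ?iota_uniq // iotaE big_cat big_seq1 /= EFinM.
rewrite Bt mx_event_entry_box fineK ?fin_num_measure //; last first.
  by rewrite -[X in measurable X]setTI; exact: mA.
congr (_%:E * _)%E; apply: eq_big_seq => s st; by rewrite B'E.
Qed.

Lemma entry_history_measurable s t i j : (s < t)%N ->
  measurable_fun setT
    ((fun w => A s w i j) : g_sigma_algebraType (history t) -> R).
Proof.
move=> st _ C mC; rewrite setTI; apply: sub_sigma_algebra.
exists (fun s' => if s' == s then entry_box i j C else fun _ _ => setT).
  by move=> s' i' j'; case: eqP => // _; exact: measurable_entry_box.
rewrite -mx_event_entry_box; apply/seteqP; split=> w /=.
  by move=> wC s' _; case: eqP => [->|].
by move/(_ s); rewrite mem_iota eqxx; exact.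
Qed.

Lemma expect_history_mul_entry t i j (X : T -> R) :
  bmfun (X : g_sigma_algebraType (history t) -> R) ->
  bmfun (fun w => A t w i j) ->
  Rintegral P setT (fun w => X w * A t w i j)
  = Rintegral P setT X * Rintegral P setT (fun w => A t w i j).
Proof.
move=> [mX bX] bA; apply: Rintegral_mul_independent => //.
  split=> //; apply: sub_g_sigma_algebra_measurable_fun mX.
  exact: history_measurable.
move=> B C mB mC; apply: history_independent_entry => //.
by have := mX measurableT B mB; rewrite setTI.
Qed.

End History.

(** * Random matrices with bounded measurable entries *)

Section BoundedMeasurableMatrix.
Context {R : realType} {d : measure_display} {T : measurableType d}.

Definition bmmx m n (M : T -> 'M[R]_(m, n)) := forall i j, bmfun (fun w => M w i j).

Lemma bmmx_cst m n (M : 'M[R]_(m, n)) : bmmx (fun=> M).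
Proof. by move=> i j; exact: bmfun_cst. Qed.

Lemma bmmxB m n (M N : T -> 'M[R]_(m, n)) :
  bmmx M -> bmmx N -> bmmx (fun w => M w - N w).
Proof.
by move=> bM bN i j; under eq_fun do rewrite !mxE; exact: bmfunB.
Qed.

Lemma bmmxD m n (M N : T -> 'M[R]_(m, n)) :
  bmmx M -> bmmx N -> bmmx (fun w => M w + N w).
Proof.
by move=> bM bN i j; under eq_fun do rewrite !mxE; exact: bmfunD.
Qed.

Lemma bmmxM m n p (M : T -> 'M[R]_(m, n)) (N : T -> 'M[R]_(n, p)) :
  bmmx M -> bmmx N -> bmmx (fun w => M w *m N w).
Proof.
move=> bM bN i j; under eq_fun do rewrite !mxE.
by apply: bmfun_sum => k; exact: bmfunM.
Qed.

Lemma bmmx_tr m n (M : T -> 'M[R]_(m, n)) : bmmx M -> bmmx (fun w => (M w)^T).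
Proof. by move=> bM i j; under eq_fun do rewrite !mxE; exact: bM. Qed.

(** For deterministic [v] the form is a finite linear combination of the entries of [M], so
    linearity of expectation applies. *)
Lemma Emx_quadratic_form n (P : probability T R) (M : T -> 'M[R]_n)
    (v : 'cV[R]_n) : bmmx M ->
  (v^T *m Emx P M *m v) 0 0 = Rintegral P setT (fun w => (v^T *m M w *m v) 0 0).
Proof.
move=> bM.
have E w : (v^T *m M w *m v) 0 0 = \sum_j \sum_i (v i 0 * v j 0) * M w i j.
  rewrite mxE; apply: eq_bigr => j _; rewrite mxE mulr_suml.
  by apply: eq_bigr => i _; rewrite !mxE; ring.
under eq_Rintegral do rewrite E.
have b i j : bmfun (fun w => (v i 0 * v j 0) * M w i j).
  by apply: bmfunM => //; exact: bmfun_cst.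
rewrite expect_sum; last by move=> j; exact: bmfun_sum.
rewrite mxE; apply: eq_bigr => j _; rewrite expect_sum // mxE mulr_suml.
by apply: eq_bigr => i _; rewrite expectZl // !mxE; ring.
Qed.

End BoundedMeasurableMatrix.

(** * The two quadratic forms of the matrix inequality *)

Section QuadraticForms.
Context {R : realType} {n : nat}.
Implicit Types (A L : 'M[R]_n) (v : 'cV[R]_n).

Lemma quadratic_form_ones L v :
  (v^T *m (L^T *m ones *m ones^T *m L) *m v) 0 0 = (\sum_i (L *m v) i 0) ^+ 2.
Proof.
have -> : v^T *m (L^T *m ones *m ones^T *m L) *m v
    = (ones^T *m (L *m v))^T *m (ones^T *m (L *m v)).
  by rewrite !trmx_mul trmxK !mulmxA.
rewrite mxE big_ord1 expr2 mxE; set s := _ 0 0.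
suff -> : s = \sum_i (L *m v) i 0 by [].
by rewrite /s mxE; apply: eq_bigr => i _; rewrite [_^T _ _]mxE mxE mul1r.
Qed.

Lemma sqr_norm_mulmx (w : 'cV[R]_n) : (w^T *m w) 0 0 = \sum_i w i 0 ^+ 2.
Proof. by rewrite mxE; apply: eq_bigr => i _; rewrite mxE. Qed.

Lemma quadratic_form_dissipation A v :
  let L := 1%:M - A in
  (v^T *m (L + L^T - L^T *m L) *m v) 0 0
  = \sum_j v j 0 ^+ 2 - \sum_i (A *m v) i 0 ^+ 2.
Proof.
move=> L; have -> : L + L^T - L^T *m L = 1%:M - A^T *m A.
  rewrite /L linearB /= trmx1 mulmxBl !mulmxBr !mul1mx mulmx1.
  apply/matrixP => i j; rewrite !mxE; ring.
rewrite mulmxBr mulmxBl mulmx1 mxE [X in _ + X]mxE; congr (_ - _).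
  exact: sqr_norm_mulmx.
by rewrite -sqr_norm_mulmx trmx_mul !mulmxA.
Qed.

End QuadraticForms.

(** * Mean-zero deficits and the matrix inequality *)

Section Consensus.
Context {R : realType} {n : nat} {d : measure_display} {T : measurableType d}.
Variables (P : probability T R) (A : nat -> T -> 'M[R]_n) (x0 : 'cV[R]_n).
Variables Amax alpha : R.
Hypothesis iidA : iid_mx P A.
Hypothesis A_ge0 : forall t w i j, 0 <= A t w i j.
Hypothesis A_row1 : forall t w i, \sum_(l < n) A t w i l = 1.
Hypothesis Amax_gt0 : 0 < Amax.
Hypothesis alpha_gt0 : 0 < alpha.
Hypothesis A_ae : {ae P, forall w, forall t,
  \sum_(i < n) \sum_(j < n | j != i) A t w i j <= Amax /\
  (forall i, alpha <= A t w i i)}.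
Hypothesis EL0 :
  forall t, ones^T *m Emx P (fun w => laplacian (A t w)) = 0.

Let gamma := Amax / alpha.

Lemma normr_entry_le1 t w i j : `|A t w i j| <= 1.
Proof.
rewrite ger0_norm // -(A_row1 t w i) (bigD1 j) //= lerDl.
by apply: sumr_ge0 => k _.
Qed.

Lemma bmmx_step t : bmmx (A t).
Proof.
by move=> i j; split; [case: iidA|exists 1 => w; exact: normr_entry_le1].
Qed.

Lemma bmmx_step_history s t : (s < t)%N ->
  bmmx (A s : g_sigma_algebraType (history A t) -> _).
Proof.
move=> st i j; split; first exact: entry_history_measurable.
by exists 1 => w; exact: normr_entry_le1.
Qed.

Lemma bmfun_col_deficit t j : bmfun (fun w => col_deficit (A t w) j).
Proof.
apply: bmfunB; first exact: bmfun_cst.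
by apply: bmfun_sum => i; exact: bmmx_step.
Qed.

Lemma expect_col_deficit t j :
  Rintegral P setT (fun w => col_deficit (A t w) j) = 0.
Proof.
have := EL0 t; move/matrixP => /(_ 0 j); rewrite !mxE => <-.
have -> : (fun w => laplacian (A t w)) = fun w => 1%:M - A t w.
  by apply/funext => w; exact: laplacian_stochastic.
have b : bmmx (fun w => 1%:M - A t w).
  by apply: bmmxB; [exact: bmmx_cst|exact: bmmx_step].
transitivity (Rintegral P setT (fun w => \sum_i (1%:M - A t w) i j)).
  apply: eq_Rintegral => w _; rewrite /col_deficit.
  under [RHS]eq_bigr do rewrite !mxE.
  rewrite sumrB; congr (_ - _).
  by rewrite (bigD1 j) //= eqxx big1 ?addr0 // => i /negbTE ->.
rewrite expect_sum; last by move=> i; exact: b.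
by apply: eq_bigr => i _; rewrite !mxE mul1r.
Qed.

Lemma bmfun_history t (X : T -> R) :
  bmfun (X : g_sigma_algebraType (history A t) -> R) -> bmfun X.
Proof.
move=> [mX bX]; split=> //; apply: sub_g_sigma_algebra_measurable_fun mX.
exact: (history_measurable iidA).
Qed.

(** The deficit is affine in the entries of [A t], so factoring the expectation entry by entry
    suffices; what remains is [X]'s mean times the zero mean of the deficit. *)
Lemma expect_history_mul_col_deficit t j (X : T -> R) :
  bmfun (X : g_sigma_algebraType (history A t) -> R) ->
  Rintegral P setT (fun w => X w * col_deficit (A t w) j) = 0.
Proof.
move=> bX; have bXT := bmfun_history bX.
rewrite -[RHS](mulr0 (Rintegral P setT X)) -(expect_col_deficit t j).
have bA i : bmfun (fun w => A t w i j) by exact: bmmx_step.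
have bXA i : bmfun (fun w => X w * A t w i j) by exact: bmfunM.
under eq_Rintegral do rewrite /col_deficit mulrBr mulr1 mulr_sumr.
rewrite expectB //; last exact: bmfun_sum.
rewrite expectB; [|exact: bmfun_cst|exact: bmfun_sum].
rewrite expect_cst mulrBr mulr1 !expect_sum // mulr_sumr.
by congr (_ - _); apply: eq_bigr => i _; exact: expect_history_mul_entry.
Qed.

Lemma loewner_drift t :
  loewner_le
    (Emx P (fun w => (laplacian (A t w))^T *m ones *m ones^T *m laplacian (A t w)))
    (gamma *: Emx P (fun w => laplacian (A t w) + (laplacian (A t w))^T
                              - (laplacian (A t w))^T *m laplacian (A t w))).
Proof.
move=> v.
have bL : bmmx (fun w => laplacian (A t w)).
  under eq_fun do rewrite laplacian_stochastic //.
  by apply: bmmxB; [exact: bmmx_cst|exact: bmmx_step].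
have bLT := bmmx_tr bL.
have bones := @bmmx_cst R _ T _ _ (@ones R n).
have b1 : bmmx (fun w => (laplacian (A t w))^T *m ones *m ones^T *m laplacian (A t w)).
  by apply: bmmxM => //; apply: bmmxM; [exact: bmmxM|exact: bmmx_tr].
have b2 : bmmx (fun w => laplacian (A t w) + (laplacian (A t w))^T
                         - (laplacian (A t w))^T *m laplacian (A t w)).
  by apply: bmmxB; [exact: bmmxD|exact: bmmxM].
have bq M : bmmx M -> bmfun (fun w : T => (v^T *m M w *m v) 0 0).
  move=> bM; suff : bmmx (fun w => v^T *m M w *m v) by [].
  by do !apply: bmmxM => //; exact: bmmx_cst.
rewrite mulmxBr mulmxBl mxE [X in _ + X]mxE -scalemxAr -scalemxAl mxE.
rewrite !Emx_quadratic_form // subr_ge0 -expectZl; last exact: bq.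
(* The deficit term of [quadratic_drift_ge]. Having mean zero, it can be added under the left
   expectation, where the almost sure inequality then applies. *)
pose D := fun w => gamma * \sum_j v j 0 ^+ 2 * col_deficit (A t w) j.
have bD j : bmfun (fun w => v j 0 ^+ 2 * col_deficit (A t w) j).
  by apply: bmfunM; [exact: bmfun_cst|exact: bmfun_col_deficit].
have bDs : bmfun (fun w => \sum_j v j 0 ^+ 2 * col_deficit (A t w) j).
  exact: bmfun_sum.
have D0 : Rintegral P setT D = 0.
  rewrite expectZl // expect_sum // big1 ?mulr0 // => j _.
  by rewrite expectZl ?expect_col_deficit ?mulr0 //; exact: bmfun_col_deficit.
rewrite -[leLHS]addr0 -D0 -expectD; [|exact: bq|exact: bmfunM (bmfun_cst _) bDs].
apply: le_expect_ae.
- by apply: bmfunD; [exact: bq|exact: bmfunM (bmfun_cst _) bDs].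
- by apply: bmfunM; [exact: bmfun_cst|exact: bq].
apply: filterS A_ae => w /(_ t)[AM Aal].
rewrite quadratic_form_ones laplacian_stochastic //.
rewrite quadratic_form_dissipation sum_laplacian_mulmx /D.
under [X in _ + _ * X]eq_bigr do rewrite mulrC.
exact: quadratic_drift_ge.
Qed.

(** * Decrease of the expected energy along trajectories *)

Definition centered t w : 'cV[R]_n := traj A x0 t w - avg x0 *: ones.

(** Unit row sums make [A t w] fix [ones], so subtracting a constant vector preserves the
    recursion. *)
Lemma centeredS t w : centered t.+1 w = A t w *m centered t w.
Proof.
rewrite /centered /= laplacian_stochastic // mulmxBl mul1mx opprB addrCA subrr addr0.
rewrite mulmxBr -scalemxAr; congr (_ - _ *: _).
apply/matrixP => i j; rewrite !mxE -(A_row1 t w i).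
by apply: eq_bigr => k _; rewrite mxE mulr1.
Qed.

Lemma bmmx_centered_history s t : (s <= t)%N ->
  bmmx (centered s : g_sigma_algebraType (history A t) -> _).
Proof.
elim: s => [|s IH] st; first exact: (bmmx_cst (x0 - avg x0 *: ones)).
rewrite (_ : centered s.+1 = fun w => A s w *m centered s w); last first.
  by apply/funext => w; exact: centeredS.
by apply: bmmxM; [exact: bmmx_step_history|exact/IH/ltnW].
Qed.

Definition energy t w : R :=
  gamma * (\sum_j centered t w j 0 ^+ 2) + (\sum_j centered t w j 0) ^+ 2.

Lemma bmfun_energy t : bmfun (energy t).
Proof.
have b j : bmfun (fun w => centered t w j 0).
  exact/bmfun_history/(bmmx_centered_history (leqnn t)).
apply: bmfunD; last exact/bmfunX/bmfun_sum.
by apply: bmfunM; [exact: bmfun_cst|apply: bmfun_sum => j; exact: bmfunX].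
Qed.

Lemma expect_energyS t :
  Rintegral P setT (energy t.+1) <= Rintegral P setT (energy t).
Proof.
(* With [S] the sum of the centered state and [D] its deficit-weighted sum, the new sum is [S - D].
   The [D ^+ 2] from its square cancels against the drift bound; the remaining [2 * S * D] and the
   deficit term of that bound combine into these coefficients. *)
pose X j w := gamma * centered t w j 0 ^+ 2
              + 2 * (\sum_k centered t w k 0) * centered t w j 0.
have b j : bmfun ((fun w => centered t w j 0) : g_sigma_algebraType (history A t) -> R).
  exact: bmmx_centered_history.
have bX j : bmfun (X j : g_sigma_algebraType (history A t) -> R).
  apply: bmfunD; apply: bmfunM => //; [exact: bmfun_cst|exact: bmfunX|].
  by apply: bmfunM; [exact: bmfun_cst|exact: bmfun_sum].
have bXc j : bmfun (fun w => X j w * col_deficit (A t w) j).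
  by apply: bmfunM; [exact: bmfun_history|exact: bmfun_col_deficit].
have E0 : Rintegral P setT (fun w => \sum_j X j w * col_deficit (A t w) j) = 0.
  by rewrite expect_sum // big1 // => j _; exact: expect_history_mul_col_deficit.
rewrite -[leLHS]addr0 -E0 -expectD; [|exact: bmfun_energy|exact: bmfun_sum].
apply: le_expect_ae; [|exact: bmfun_energy|].
  by apply: bmfunD; [exact: bmfun_energy|exact: bmfun_sum].
apply: filterS A_ae => w /(_ t)[AM Aal].
have := quadratic_drift_ge (centered t w) (A_ge0 t w) (A_row1 t w)
  Amax_gt0 alpha_gt0 AM Aal; rewrite -/gamma.
have := sum_laplacian_mulmx (A t w) (centered t w).
rewrite /energy centeredS mulmxBl mul1mx.
under eq_bigr do rewrite mxE [X in _ + X]mxE.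
rewrite sumrB.
have -> : \sum_j X j w * col_deficit (A t w) j
    = gamma * (\sum_j col_deficit (A t w) j * centered t w j 0 ^+ 2)
      + 2 * (\sum_k centered t w k 0)
          * (\sum_j col_deficit (A t w) j * centered t w j 0).
  rewrite /X; set S := \sum_k centered t w k 0.
  by rewrite !mulr_sumr -big_split; apply: eq_bigr => j _ /=; ring.
set S := \sum_k centered t w k 0.
set S' := \sum_i (A t w *m centered t w) i 0.
set D := \sum_j col_deficit (A t w) j * centered t w j 0.
move=> SE; have -> : S' = S - D by rewrite -SE; ring.
by rewrite mulrBr sqrrB; lra.
Qed.

(** Initially the deviations from the average sum to zero, so only the squared norm contributes. *)
Lemma energy0 w : (0 < n)%N -> energy 0 w = gamma * (n%:R * Var x0).
Proof.
move=> n0; have n0' : n%:R != 0 :> R by rewrite pnatr_eq0 -lt0n.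
have cE j : centered 0 w j 0 = x0 j 0 - avg x0 by rewrite !mxE mulr1.
rewrite /energy; under eq_bigr do rewrite cE.
under [X in _ + X ^+ 2]eq_bigr do rewrite cE.
rewrite sumrB sumr_const card_ord -[avg x0 *+ n]mulr_natr [avg x0 * _]divfK // subrr.
by rewrite expr0n addr0 /Var [n%:R * _]mulrC divfK.
Qed.

Lemma expect_energy_le t : (0 < n)%N ->
  Rintegral P setT (energy t) <= gamma * (n%:R * Var x0).
Proof.
move=> n0; elim: t => [|t IH]; last exact: le_trans (expect_energyS t) IH.
by rewrite (eq_Rintegral _ (fun w _ => energy0 w n0)) expect_cst.
Qed.

(** With [a] the deviation of the average, the centered state sums to [n%:R * a], and Cauchy-Schwarz
    with unit weights bounds its squared norm below by [n%:R * a ^+ 2]. *)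
Lemma avg_deviation_le_energy t w : (0 < n)%N ->
  n%:R * (n%:R + gamma) * (avg (traj A x0 t w) - avg x0) ^+ 2 <= energy t w.
Proof.
move=> n0; have n0' : n%:R != 0 :> R by rewrite pnatr_eq0 -lt0n.
have SE : \sum_j centered t w j 0 = n%:R * (avg (traj A x0 t w) - avg x0).
  under eq_bigr do rewrite !mxE mulr1.
  rewrite sumrB sumr_const card_ord -[avg x0 *+ n]mulr_natl mulrBr; congr (_ - _).
  by rewrite [RHS]mulrC divfK.
have CS : (\sum_j centered t w j 0) ^+ 2
    <= n%:R * \sum_j centered t w j 0 ^+ 2.
  have := @weighted_cauchy_schwarz R 'I_n xpredT (fun=> 1)
    (fun j => centered t w j 0) n%:R (fun _ _ => ler01).
  rewrite sumr_const card_ord => /(_ (lexx _)).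
  by under eq_bigr do rewrite mul1r; under [in leRHS]eq_bigr do rewrite mul1r.
move: CS; rewrite /energy SE exprMn; set Q := \sum_j _; set a := avg _ - _.
rewrite expr2 -!mulrA ler_pM2l ?ltr0n // => CS.
have g0 : 0 < gamma by rewrite divr_gt0.
by have := ler_wpM2l (ltW g0) CS; rewrite [Amax * _]mulrA -/gamma; lra.
Qed.

Lemma expect_avg_deviation_le t :
  (\int[P]_w ((avg (traj A x0 t w) - avg x0) ^+ 2)%:E
     <= (gamma / (n%:R + gamma) * Var x0)%:E)%E.
Proof.
have g0 : 0 < gamma by rewrite divr_gt0.
(* Without nodes, all sums are empty and both sides are zero. *)
have [n0|n0] := posnP n.
  have no_i (i : 'I_n) : False by case: i => i; rewrite n0.
  rewrite [X in (_ <= X)%E](_ : _ = 0%E); last first.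
    by rewrite /Var big1 ?mul0r ?mulr0 // => i; case: (no_i i).
  rewrite integral0_eq // => w _; rewrite /avg.
  by rewrite !big1 ?mul0r ?subrr ?expr0n // => i; case: (no_i i).
have ng0 : 0 < n%:R + gamma by rewrite addr_gt0 ?ltr0n.
have ngn0 : 0 < n%:R * (n%:R + gamma) by rewrite mulr_gt0 ?ltr0n.
have b : bmfun (fun w => (avg (traj A x0 t w) - avg x0) ^+ 2).
  have bc j : bmfun (fun w => centered t w j 0).
    exact/bmfun_history/(bmmx_centered_history (leqnn t)).
  apply: bmfunX; apply: bmfunB; last exact: bmfun_cst.
  apply: bmfunM; last exact: bmfun_cst.
  apply: bmfun_sum => j.
  rewrite (_ : (fun w => _) = fun w => centered t w j 0 + avg x0).
    by apply: bmfunD => //; exact: bmfun_cst.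
  by apply/funext => w; rewrite !mxE mulr1 subrK.
(* The integrand is bounded, so the integral is finite and the claim becomes one about reals, to be
   multiplied by [n%:R * (n%:R + gamma)]. *)
rewrite -[leLHS]fineK; last first.
  exact: (integrable_fin_num measurableT (bmfun_integrable P b)).
rewrite lee_fin -(ler_pM2l ngn0) -[leLHS](expectZl P _ b).
have -> : n%:R * (n%:R + gamma) * (gamma / (n%:R + gamma) * Var x0)
    = gamma * (n%:R * Var x0) by field; rewrite gt_eqF.
apply: le_trans (expect_energy_le t n0); apply: le_expect_ae.
- by apply: bmfunM => //; exact: bmfun_cst.
- exact: bmfun_energy.
- by apply: aeW => w; exact: avg_deviation_le_energy.
Qed.

End Consensus.

Theorem theorem3 (R : realType) (n : nat) (d : measure_display)
  (T : measurableType d) (P : probability T R)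
  (A : nat -> T -> 'M[R]_n) (x0 : 'cV[R]_n) (Amax alpha : R) :
  iid_mx P A ->
  (* standing assumptions: nonnegative, row-stochastic *)
  (forall t w i j, 0 <= A t w i j) ->
  (forall t w i, \sum_(l < n) A t w i l = 1) ->
  0 < Amax -> 0 < alpha ->
  (* almost surely: total off-diagonal weight <= Amax, a_ii >= alpha *)
  {ae P, forall w, forall t,
     \sum_(i < n) \sum_(j < n | j != i) A t w i j <= Amax /\
     (forall i, alpha <= A t w i i)} ->
  (* 1^* E(L(t)) = 0 *)
  (forall t, (ones^T *m Emx P (fun w => laplacian (A t w))) = 0) ->
  let gamma := Amax / alpha in
  (forall t,
     loewner_le
       (Emx P (fun w => (laplacian (A t w))^T *m ones *m ones^T *m laplacian (A t w)))
       (gamma *: Emx P (fun w => laplacian (A t w) + (laplacian (A t w))^T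
                                 - (laplacian (A t w))^T *m laplacian (A t w)))) /\
  (forall t,
     (\int[P]_w ((avg (traj A x0 t w) - avg x0) ^+ 2)%:E
        <= (gamma / (n%:R + gamma) * Var x0)%:E)%E).
Proof.
move=> iidA A_ge0 A_row1 Amax_gt0 alpha_gt0 A_ae EL0 gamma; split=> t.
  exact: loewner_drift.
exact: expect_avg_deviation_le.
Qed.
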